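(* Let $f(x)=x+\sum_{n\geq 2}a_nx^n\in\mathbb{C}[[x]]$ with $a_n\in\mathbb{C}$, and let $V$ be a vertex operator algebra (over $\mathbb{C}$) with Virasoro operators $L(j)$, $j\in\mathbb{Z}$. Let $(A_j)_{j\geq 1}$ and $(b_j)_{j\geq 1}$ be the unique sequences of complex numbers such that $$\exp\left(\sum_{j\geq 1}A_jx^{j+1}\frac{d}{dx}\right)\cdot x=f(x)$$ and $$\cdots\exp\left(b_3x^4\frac{d}{dx}\right)\exp\left(b_2x^3\frac{d}{dx}\right)\exp\left(b_1x^2\frac{d}{dx}\right)\cdot x=f(x).$$ Define linear automorphisms of $V$ by $$\varphi_f=\exp\left(-\sum_{j\geq 1}A_jL(j)\right),\qquad \widetilde{\varphi}_f=\cdots\exp(-b_3L(3))\exp(-b_2L(2))\exp(-b_1L(1)).$$ Then $\widetilde{\varphi}_f=\varphi_f$.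
   Context: All series are formal; $f(x)$ is not assumed to converge. The operators $x^{j+1}\frac{d}{dx}$, $j\geq 1$, act on $\mathbb{C}[[x]]$ and raise degrees of monomials by $j$, so the exponential of the infinite sum and the infinite product (extending to the left, the factor with index $1$ acting first) are well-defined operators on $\mathbb{C}[[x]]$. It is a fact that the sequences $(A_j)$ and $(b_j)$ exist and are unique for the given $f$. A vertex operator algebra $V$ is understood in the standard sense (Frenkel–Lepowsky–Meurman): it has a conformal vector $\omega$ with $Y(\omega,x)=\sum_{n\in\mathbb{Z}}L(n)x^{-n-2}$, where the $L(n)$ satisfy the Virasoro algebra relations; $V$ is $\mathbb{Z}$-graded by $L(0)$-eigenvalues with finite-dimensional weight spaces and with grading bounded below. $L(j)$ corresponds to the derivation $-x^{j+1}\frac{d}{dx}$, and lowers weight by $j$. For each $v\in V$, $L(j)v=0$ for $j$ sufficiently large, and the maps $\varphi_f$ and $\widetilde{\varphi}_f$ are well defined on $V$: applied to any fixed $v$, only finitely many terms (respectively factors) act nontrivially. *)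

(* Defs.v *)
From HB Require Import structures.
From mathcomp Require Import all_boot all_order all_algebra.
From mathcomp Require Import boolp classical_sets functions filter reals.
From mathcomp Require Import complex.

Set Implicit Arguments.
Unset Strict Implicit.
Unset Printing Implicit Defensive.

Import Order.TTheory GRing.Theory Num.Theory.
Local Open Scope classical_set_scope.
Local Open Scope ring_scope.

(* The value at which a sequence stabilizes, i.e. its limit for the discrete
   topology; by convention 0 when the sequence does not stabilize. *)
Definition stable_val (T : zmodType) (u : nat -> T) : T :=
  xget 0 [set l | \forall n \near \oo, u n = l].

(* Infinite sums, exponentials and infinite products of operators on a module U,
   evaluated pointwise. The parameter [lim] says how a sequence of elements of U
   is evaluated: coefficientwise stabilization on formal power series
   ([fps_lim]), plain stabilization on a vertex operator algebra
   ([stable_val]). Families are indexed by j >= 1: the value at 0 is unused. *)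
Section Operators.
Variables (K : fieldType) (U : lmodType K) (lim : (nat -> U) -> U).

Definition opsum (T : nat -> U -> U) : U -> U :=
  fun v => lim (fun N => \sum_(1 <= j < N) T j v).

Definition opexp (T : U -> U) : U -> U :=
  fun v => lim (fun N => \sum_(k < N) (k`!%:R : K)^-1 *: iter k T v).

(* T N (... (T 2 (T 1 v))) *)
Fixpoint partial_prod (T : nat -> U -> U) (N : nat) (v : U) : U :=
  if N is N'.+1 then T N (partial_prod T N' v) else v.

Definition opprod (T : nat -> U -> U) : U -> U :=
  fun v => lim (fun N => partial_prod T N v).

End Operators.

(* A formal power series is its sequence of coefficients. The K-module structure
   is the pointwise one. *)
Definition fps (K : fieldType) : Type := nat -> K.
HB.instance Definition _ (K : fieldType) :=
  GRing.Lmodule.copy (fps K) (nat -> K^o).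

Section FormalPowerSeries.
Variable K : fieldType.
Implicit Type g : fps K.

Definition fps_lim (u : nat -> fps K) : fps K :=
  fun n => stable_val (fun N => u N n).

Definition fpsX : fps K := fun n => (n == 1%N)%:R.

Definition fps_deriv g : fps K := fun n => n.+1%:R * g n.+1.

Definition fps_mulXn (k : nat) g : fps K :=
  fun n => if (n < k)%N then 0 else g (n - k)%N.

(* x^(j+1) d/dx *)
Definition vfield (j : nat) g : fps K := fps_mulXn j.+1 (fps_deriv g).

Definition exp_sum_vfield (A : nat -> K) : fps K -> fps K :=
  opexp fps_lim (opsum fps_lim (fun j g => A j *: vfield j g)).

Definition prod_exp_vfield (b : nat -> K) : fps K -> fps K :=
  opprod fps_lim (fun j => opexp fps_lim (fun g => b j *: vfield j g)).

End FormalPowerSeries.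

Definition int_binom (K : fieldType) (m : int) (i : nat) : K :=
  (\prod_(k < i) (m - k%:Z)%:~R) / i`!%:R.

Record voa_data (K : numFieldType) (V : lmodType K) := VoaData {
  (* [Y v n] is the coefficient v_n of x^(-n-1) in Y(v, x). *)
  Y : V -> int -> {linear V -> V};
  vac : V;
  omega : V;
  rank : K }.

Section VertexOperatorAlgebra.
Variables (K : numFieldType) (V : lmodType K) (D : voa_data V).
Local Notation Y := (Y D).
Local Notation vac := (vac D).
Local Notation omega := (omega D).
Local Notation rank := (rank D).

(* From Y(omega, x) = sum_n L(n) x^(-n-2) *)
Definition L (n : int) : V -> V := Y omega (n + 1).

Definition weight_space (n : int) : set V := [set v | L 0 v = n%:~R *: v].

Definition finite_dim (W : set V) : Prop :=
  exists (d : nat) (e : 'I_d -> V), (forall i, W (e i)) /\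
    forall v, W v -> exists c : 'I_d -> K, v = \sum_(i < d) c i *: e i.

(* The coefficient of x0^(-l-1) x1^(-m-1) x2^(-n-1) in
     x0^-1 delta((x1 - x2)/x0) Y(u, x1) Y(v, x2)
     - x0^-1 delta((x2 - x1)/(-x0)) Y(v, x2) Y(u, x1)
     = x2^-1 delta((x1 - x0)/x2) Y(Y(u, x0) v, x2)
   applied to w, where on the right
   (-1)^i binom(-m-1+i, i) = binom(m, i). By the truncation axiom all these
   sums over i >= 0 are finite, so the partial sums agree eventually. *)
Definition jacobi_identity : Prop :=
  forall (u v w : V) (l m n : int),
  \forall N \near \oo,
    \sum_(i < N) ((-1) ^+ i * int_binom K l i) *:
      (Y u (m + l - i%:Z) (Y v (n + i%:Z) w)
       - (-1) ^ l *: Y v (n + l - i%:Z) (Y u (m + i%:Z) w))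
    = \sum_(i < N) int_binom K m i *: Y (Y u (l + i%:Z) v) (m + n - i%:Z) w.

Record voa_axioms : Prop := VoaAxioms {
  Y_linear : forall n w, linear (fun v => Y v n w);
  Y_truncation : forall u v, exists N : int, forall n : int, N <= n -> Y u n v = 0;
  Y_vacuum : forall n v, Y vac n v = if n == -1 then v else 0;
  Y_creation : forall v,
    Y v (-1) vac = v /\ forall n : int, 0 <= n -> Y v n vac = 0;
  Y_jacobi : jacobi_identity;
  L_virasoro : forall (m n : int) v,
    L m (L n v) - L n (L m v) = (m - n)%:~R *: L (m + n) v
      + (if m + n == 0 then (m ^+ 3 - m)%:~R / 12%:R * rank else 0) *: v;
  (* Y(L(-1)v, x) = d/dx Y(v, x) *)
  L_derivative : forall v n w, Y (L (-1) v) n w = - n%:~R *: Y v (n - 1) w;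
  (* V is the sum of its L(0)-eigenspaces of integral eigenvalue; directness is
     automatic in characteristic 0. *)
  weight_decomposition : forall v, exists (s : seq int) (c : int -> V),
    (forall n, weight_space n (c n)) /\ v = \sum_(n <- s) c n;
  weight_finite_dim : forall n, finite_dim (weight_space n);
  weight_bounded_below : exists N : int, forall (n : int) v,
    n < N -> weight_space n v -> v = 0;
  vac_weight : weight_space 0 vac;
  omega_weight : weight_space 2 omega }.

End VertexOperatorAlgebra.

Record voa (K : numFieldType) (V : lmodType K) := Voa {
  voa_dataOf :> voa_data V;
  voaP : voa_axioms voa_dataOf }.

Section Phi.
Variables (K : numFieldType) (V : lmodType K) (S : voa V).

Definition phi (A : nat -> K) : V -> V :=
  opexp (@stable_val V)
    (fun v => - opsum (@stable_val V) (fun j w => A j *: L S j%:Z w) v).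

Definition phi_tilde (b : nat -> K) : V -> V :=
  opprod (@stable_val V)
    (fun j => opexp (@stable_val V) (fun v => - b j *: L S j%:Z v)).

End Phi.

(* Main.v *)
(* Both automorphisms are products of exponentials of operators from the positive
   half of the Witt algebra, so each of them, G say, satisfies
   G L(0) = (L(0) + sum_(j >= 1) c_j L(j)) G with coefficients c_j that depend
   only on A, respectively b, and not on the module. Acting on x in C[[x]], where
   L(j) = - x^(j+1) d/dx, this identity becomes
   (x + sum_j c_j x^(j+1)) f'(x) = f(x), which determines the c_j because f'(x) is
   invertible: they agree for A and b. On V two such operators G, which moreover
   are the identity up to terms of lower weight, coincide on eigenvectors of
   L(0): if their difference on a vector of weight n has weights at most n - p,
   p >= 1, comparing the components of weight n - p shows that it has weights at
   most n - p - 1, and the weights of V are bounded below.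
   Infinite sums and products are avoided by fixing P and working in modules with
   a filtration whose P-th term is 0: sums of vectors of bounded weight in V, and
   power series modulo x^(P+1). *)
Require Import Defs.
From HB Require Import structures.
From mathcomp Require Import all_boot all_order all_algebra.
From mathcomp Require Import boolp classical_sets functions filter reals.
From mathcomp Require Import complex ring zify.

Set Implicit Arguments.
Unset Strict Implicit.
Unset Printing Implicit Defensive.

Import Order.TTheory GRing.Theory Num.Theory.
Local Open Scope ring_scope.

(** Serves both for the bracket of two series of operators and for the product of two exponential
    series. *)
Lemma sum_antidiagonal (W : nmodType) (P : nat) (g : nat -> nat -> W) :
  (forall i j, (P <= i + j)%N -> g i j = 0) ->
  \sum_(i < P) \sum_(j < P) g i j = \sum_(n < P) \sum_(i < n.+1) g i (n - i)%N.
Proof.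
move=> g0.
transitivity (\sum_(n < P) \sum_(i < P | (i <= n)%N) g i (n - i)%N); last first.
  apply: eq_bigr => n _.
  by rewrite (big_ord_widen_cond P xpredT (fun i => g i (n - i)%N)) ?ltn_ord.
rewrite [RHS](exchange_big_dep xpredT) //=; apply: eq_bigr => i _.
have iP : (i <= P)%N by exact: ltnW.
transitivity (\sum_(0 <= n < P | (i <= n)%N) g i (n - i)%N); last first.
  by rewrite big_mkord.
rewrite [RHS](big_cat_nat (n := i)) //= [X in X + _]big_nat_cond.
rewrite [X in X + _]big_pred0 ?add0r; last first.
  by move=> k; lia.
rewrite [RHS]big_nat_cond [RHS](eq_bigl (fun n => i <= n < P)%N); last by move=> k; lia.
rewrite -[RHS]big_nat.
have := @big_addn W 0 +%R 0 P i xpredT (fun n => g i (n - i)%N); rewrite add0n => ->.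
rewrite -(big_mkord xpredT (g i)) (big_cat_nat (n := P - i)) ?leq_subr //=.
rewrite [X in _ + X]big_nat [X in _ + X]big1 ?addr0; last first.
  by move=> k kP; apply: g0; lia.
by apply: eq_bigr => k _; rewrite addnK.
Qed.

(** * The adjoint action on coefficient sequences *)

Section Witt.
Variable K : numFieldType.
Implicit Types a c : nat -> K.

(** Coefficients of the bracket of sum_i a_i l_i with sum_j c_j l_j, given [l_i, l_j] = (i - j)
    l_(i+j). *)
Definition witt_ad a c : nat -> K := fun m =>
  \sum_(i < m.+1) (i%:R - (m - i)%:R) * a i * c (m - i)%N.

(** The series exp(ad a) applied to c, cut after P terms; if a_0 = 0, its entries of index below P
    are those of the full series. *)
Definition witt_Ad (P : nat) a c : nat -> K := fun m =>
  \sum_(k < P) k`!%:R^-1 * iter k (witt_ad a) c m.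

Lemma iter_witt_ad_eq0 a c k m : a 0%N = 0 -> (m < k)%N ->
  iter k (witt_ad a) c m = 0.
Proof.
move=> a0; elim: k m => // k IH m mk /=.
rewrite /witt_ad big1 // => -[[|i] im] _ /=; first by rewrite a0 mulr0 mul0r.
by rewrite IH ?mulr0 //; lia.
Qed.

Definition single (j : nat) (x : K) : nat -> K := fun m => if m == j then x else 0.

(** Coefficients of l_0, which is [single 0 1], conjugated by the exponentials of index 1 to N in
    turn. *)
Fixpoint witt_prod (P : nat) (b : nat -> K) (N : nat) : nat -> K :=
  if N is N'.+1 then witt_Ad P (single N (b N)) (witt_prod P b N') else single 0 1.

Lemma witt_Ad0 P a c : a 0%N = 0 -> (0 < P)%N -> witt_Ad P a c 0 = c 0%N.
Proof.
move=> a0; case: P => // P _; rewrite /witt_Ad big_ord_recl /= invr1 mul1r.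
rewrite big1 ?addr0 // => i _.
by rewrite -iterS iter_witt_ad_eq0 ?mulr0.
Qed.

Lemma witt_prod0 P b N : (0 < P)%N -> witt_prod P b N 0 = 1.
Proof. by move=> P0; elim: N => //= N IH; rewrite witt_Ad0. Qed.

(** Since l_j raises the degree by j and step P is zero, all series and exponentials become finite
    sums on [F 0]. This step may be a proper subspace: vectors of bounded weight, or series without
    constant term. *)
Record witt_filtration (U : lmodType K) (l : nat -> {linear U -> U})
    (F : nat -> U -> Prop) (P : nat) : Prop := WittFiltration {
  filt0 : forall p, F p 0;
  filtD : forall p u v, F p u -> F p v -> F p (u + v);
  filtZ : forall p x u, F p u -> F p (x *: u);
  filt_le : forall p q u, (q <= p)%N -> F p u -> F q u;
  filt_op : forall p j u, F p u -> F (p + j)%N (l j u);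
  filt_sep : forall u, F P u -> u = 0;
  witt_bracket : forall m n u,
    l m (l n u) - l n (l m u) = (m%:R - n%:R) *: l (m + n)%N u }.

(** * Series of operators on a filtered module *)

Section Module.
Variables (U : lmodType K) (l : nat -> {linear U -> U}) (F : nat -> U -> Prop).
Variable P : nat.
Hypothesis FP : witt_filtration l F P.

Definition series_op c : U -> U := fun u => \sum_(j < P) c j *: l j u.

Lemma series_op_is_linear c : linear (series_op c).
Proof.
move=> x u v; rewrite /series_op scaler_sumr -big_split /=; apply: eq_bigr => j _.
by rewrite linearP scalerDr !scalerA mulrC.
Qed.
HB.instance Definition _ c :=
  GRing.isLinear.Build K U U *:%R (series_op c) (series_op_is_linear c).

Lemma filt_sum p (I : Type) (r : seq I) (Q : pred I) (G : I -> U) :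
  (forall i, Q i -> F p (G i)) -> F p (\sum_(i <- r | Q i) G i).
Proof.
move=> h; elim/big_ind: _ => //; [exact: filt0 FP _|exact: filtD FP _].
Qed.

Lemma filtB p u v : F p u -> F p v -> F p (u - v).
Proof.
by move=> hu hv; rewrite -scaleN1r; apply: (filtD FP) => //; apply: (filtZ FP).
Qed.

Lemma filt_eq0 p u : (P <= p)%N -> F p u -> u = 0.
Proof. by move=> Pp /(filt_le FP Pp) /(filt_sep FP). Qed.

Lemma filt_series_op k c p u : (forall m, (m < k)%N -> c m = 0) ->
  F p u -> F (p + k) (series_op c u).
Proof.
move=> c0 Fu; apply: filt_sum => j _; have [/c0 ->|kj] := ltnP j k.
  by rewrite scale0r; apply: filt0 FP _.
by apply/(filtZ FP)/(filt_le FP (p := p + j)); [rewrite leq_add2l|apply: (filt_op FP)].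
Qed.

Lemma filt_iter_series_op a p k u : a 0%N = 0 -> F p u ->
  F (p + k) (iter k (series_op a) u).
Proof.
move=> a0 Fu; elim: k => [|k IH]; first by rewrite addn0.
by rewrite addnS -addn1; apply: filt_series_op IH => -[].
Qed.

Lemma series_opN c u : series_op (fun j => - c j) u = - series_op c u.
Proof. by rewrite /series_op -sumrN; apply: eq_bigr => j _; rewrite scaleNr. Qed.

Lemma eq_series_op c c' u : (forall j, (j < P)%N -> c j = c' j) ->
  series_op c u = series_op c' u.
Proof. by move=> cc'; apply: eq_bigr => j _; rewrite cc'. Qed.

(** Cutting both series at P is harmless: the terms l_(i+j) u with i + j >= P lie in the zero step
    [F P]. *)
Lemma series_op_bracket a c u : F 0 u ->
  series_op a (series_op c u) - series_op c (series_op a u)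
  = series_op (witt_ad a c) u.
Proof.
move=> Fu.
pose g i j := ((i%:R - j%:R) * a i * c j) *: l (i + j)%N u.
transitivity (\sum_(i < P) \sum_(j < P) g i j).
  rewrite /series_op.
  under eq_bigr do rewrite linear_sum scaler_sumr.
  under [X in _ - X]eq_bigr do rewrite linear_sum scaler_sumr.
  rewrite [X in _ - X]exchange_big -sumrB; apply: eq_bigr => i _.
  rewrite -sumrB; apply: eq_bigr => j _.
  rewrite /g -mulrA mulrC -scalerA -(witt_bracket FP) !linearZ /= !scalerA.
  by rewrite [c j * _]mulrC -scalerDr.
rewrite sum_antidiagonal; last first.
  move=> i j Pij; rewrite /g (@filt_eq0 _ (l (i + j)%N u) Pij) ?scaler0 //.
  exact: (filt_op FP (p := 0)).
apply: eq_bigr => n _; rewrite /g /witt_ad scaler_suml; apply: eq_bigr => i _.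
by rewrite subnKC // -ltnS.
Qed.

(* The Leibniz rule for the divided powers of [series_op a]. *)
Lemma divided_power_series_op a c n u : a 0%N = 0 -> F 0 u ->
  n`!%:R^-1 *: iter n (series_op a) (series_op c u) =
  \sum_(k < n.+1)
     series_op (fun m => k`!%:R^-1 * iter k (witt_ad a) c m)
       ((n - k)`!%:R^-1 *: iter (n - k) (series_op a) u).
Proof.
move=> a0 Fu.
pose d n v := n`!%:R^-1 *: iter n (series_op a) v.
pose ck k m := k`!%:R^-1 * iter k (witt_ad a) c m.
have dS k v : series_op a (d k v) = k.+1%:R *: d k.+1 v.
  rewrite /d linearZ /= scalerA; congr (_ *: _).
  by rewrite factS natrM invfM mulrA divff ?mul1r // pnatr_eq0.
have ckS k v : series_op (witt_ad a (ck k)) v = k.+1%:R *: series_op (ck k.+1) v.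
  rewrite /series_op scaler_sumr; apply: eq_bigr => m _; rewrite scalerA.
  congr (_ *: _); rewrite /ck factS natrM invfM !mulrA divff ?pnatr_eq0 // mul1r.
  by rewrite /= /witt_ad mulr_sumr; apply: eq_bigr => i _; rewrite mulrCA !mulrA.
have Fd k : F 0 (d k u).
  apply: (filtZ FP); apply: (filt_le FP (leq0n (0 + k))).
  exact: filt_iter_series_op.
suff: d n (series_op c u) = \sum_(k < n.+1) series_op (ck k) (d (n - k)%N u) by [].
elim: n => [|n IH].
  rewrite big_ord1 /= subnn /d /= invr1 !scale1r /series_op.
  by apply: eq_bigr => m _; rewrite /ck /= invr1 mul1r.
have n0 : n.+1%:R != 0 :> K by rewrite pnatr_eq0.
apply: (scalerI n0); rewrite -dS IH linear_sum /=.
transitivity (\sum_(k < n.+1) (n.+1 - k)%:R *: series_op (ck k) (d (n.+1 - k)%N u)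
   + \sum_(k < n.+1) k.+1%:R *: series_op (ck k.+1) (d (n - k)%N u)).
  rewrite -big_split; apply: eq_bigr => k _ /=.
  have /(canRL (subrK _)) -> := series_op_bracket a (ck k) (Fd (n - k)%N).
  by rewrite addrC dS ckS [series_op (ck k) (_ *: _)]linearZ subSn ?leq_ord.
rewrite scaler_sumr.
(* Both sums are padded by a term with coefficient 0 to the range k <= n + 1, where (n + 1 - k) + k
   = n + 1. *)
transitivity (\sum_(k < n.+2) (n.+1 - k)%:R *: series_op (ck k) (d (n.+1 - k)%N u)
   + \sum_(k < n.+2) k%:R *: series_op (ck k) (d (n.+1 - k)%N u)).
  rewrite [X in _ = X + _]big_ord_recr /= subnn scale0r addr0; congr (_ + _).
  by rewrite [RHS]big_ord_recl /= scale0r add0r.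
rewrite -big_split; apply: eq_bigr => k _ /=.
by rewrite -scalerDl -natrD subnK // -ltnS.
Qed.

(** * Exponentials and the conjugation they induce *)

Definition exp_op a : U -> U := fun u =>
  \sum_(k < P) k`!%:R^-1 *: iter k (series_op a) u.

Lemma exp_op_is_linear a : linear (exp_op a).
Proof.
move=> x u v; rewrite /exp_op scaler_sumr -big_split /=; apply: eq_bigr => k _.
rewrite scalerA mulrC -scalerA -scalerDr; congr (_ *: _).
by elim: (k : nat) => //= m ->; rewrite linearP.
Qed.
HB.instance Definition _ a :=
  GRing.isLinear.Build K U U *:%R (exp_op a) (exp_op_is_linear a).

(** The relation e^a c = (e^(ad a) c) e^a, free of inverses. The Leibniz rule is summed over n; in
    the square k, i < P the terms with k + i >= P vanish. *)
Lemma exp_op_series_op a c u : a 0%N = 0 -> F 0 u ->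
  exp_op a (series_op c u) = series_op (witt_Ad P a c) (exp_op a u).
Proof.
move=> a0 Fu.
under [LHS]eq_bigr do rewrite divided_power_series_op //.
rewrite -(sum_antidiagonal (g := fun k i =>
  series_op (fun m => k`!%:R^-1 * iter k (witt_ad a) c m)
    (i`!%:R^-1 *: iter i (series_op a) u))).
  rewrite exchange_big /exp_op linear_sum; apply: eq_bigr => i _ /=.
  rewrite /series_op exchange_big; apply: eq_bigr => j _ /=.
  by rewrite -scaler_suml.
move=> k i Pki; apply: (@filt_eq0 (i + k)%N); first by rewrite addnC.
apply: filt_series_op => [m mk|]; first by rewrite iter_witt_ad_eq0 ?mulr0.
by apply: (filtZ FP); rewrite -[i in F i]add0n; apply: filt_iter_series_op.
Qed.

Lemma exp_op_sub p a u : a 0%N = 0 -> (0 < P)%N -> F p u -> F p.+1 (exp_op a u - u).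
Proof.
move=> a0; rewrite /exp_op; case: P => // P' _ Fu.
rewrite big_ord_recl /= invr1 scale1r addrC addKr.
apply: filt_sum => k _; apply: (filtZ FP); rewrite -iterS.
apply: (filt_le FP) (filt_iter_series_op k.+1 a0 Fu).
by rewrite addnS ltnS leq_addr.
Qed.

Lemma filt_exp_op a p u : a 0%N = 0 -> F p u -> F p (exp_op a u).
Proof.
move=> a0 Fu; apply: filt_sum => k _; apply: (filtZ FP).
by apply: (filt_le FP) (filt_iter_series_op k a0 Fu); rewrite leq_addr.
Qed.

(** * Single generators and ordered products of exponentials *)

Lemma series_op_single j x u :
  series_op (single j x) u = if (j < P)%N then x *: l j u else 0.
Proof.
rewrite /series_op /single; case: ltnP => jP.
  rewrite (bigD1 (Ordinal jP)) //= eqxx big1 ?addr0 // => i.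
  by rewrite -val_eqE /= => /negbTE ->; rewrite scale0r.
by rewrite big1 // => i _; rewrite ltn_eqF ?scale0r // (leq_trans _ jP).
Qed.

Lemma series_op_singleE j x u : F 0 u -> series_op (single j x) u = x *: l j u.
Proof.
move=> Fu; rewrite series_op_single; case: ltnP => // Pj.
by rewrite (@filt_eq0 _ (l j u) Pj) ?scaler0 //; apply: (filt_op FP (p := 0)).
Qed.

Lemma exp_op_single_id j x u : (0 < P)%N -> (P <= j)%N -> exp_op (single j x) u = u.
Proof.
rewrite /exp_op => P0 Pj; rewrite -(prednK P0) big_ord_recl /= invr1 scale1r.
rewrite big1 ?addr0 // => k _.
by rewrite -iterS /= series_op_single ltnNge Pj scaler0.
Qed.

Definition prod_op (b : nat -> K) : nat -> U -> U :=
  partial_prod (fun j => exp_op (single j (b j))).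

Lemma prod_op_is_linear b N : linear (prod_op b N).
Proof.
move=> x u v; rewrite /prod_op; elim: N => //= N IH.
by rewrite IH linearP.
Qed.
HB.instance Definition _ b N :=
  GRing.isLinear.Build K U U *:%R (prod_op b N) (prod_op_is_linear b N).

Lemma filt_prod_op b N p u : F p u -> F p (prod_op b N u).
Proof. by move=> Fu; elim: N => // N IH; apply: filt_exp_op. Qed.

Lemma prod_op_sub p b N u : (0 < P)%N -> F p u -> F p.+1 (prod_op b N u - u).
Proof.
move=> P0 Fu; elim: N => [|N IH]; first by rewrite subrr; apply: filt0 FP _.
rewrite -[prod_op b N.+1 u](subrK (prod_op b N u)) -addrA; apply: (filtD FP) => //.
by apply: exp_op_sub => //; apply: filt_prod_op.
Qed.

(** l_0 is moved past one exponential at a time, each changing the coefficients by its [witt_Ad]. *)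
Lemma prod_op_series_op b N u : F 0 u ->
  prod_op b N (series_op (single 0 1) u)
  = series_op (witt_prod P b N) (prod_op b N u).
Proof.
move=> Fu; rewrite /prod_op; elim: N => //= N ->.
by rewrite exp_op_series_op //; apply: filt_prod_op.
Qed.

(** Factors of index at least P act as the identity, so P factors already give the infinite
    product. *)
Lemma prod_op_stable b N u : (0 < P)%N -> (P <= N)%N -> prod_op b N u = prod_op b P u.
Proof.
move=> P0; elim: N => [|N IH]; first by rewrite leqn0 => /eqP ->.
rewrite leq_eqVlt => /predU1P[<-//|PN].
rewrite -IH //; apply: exp_op_single_id => //; exact: ltnW.
Qed.

(* If [c 0 = 1], the equation [G (l 0 u) = series_op c (G u)] determines [G] on
   eigenvectors: on each step of the filtration the difference of two solutions
   is an eigenvector of [l 0] for two distinct eigenvalues. *)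
Lemma eq_of_series_op_eigen (h : K) (G1 G2 : {linear U -> U}) c q u : (0 < P)%N ->
  (forall p v, F p v -> F p.+1 (l 0%N v - (h - p%:R) *: v)) -> c 0%N = 1 ->
  (forall v, F 0 v -> G1 (l 0%N v) = series_op c (G1 v)) ->
  (forall v, F 0 v -> G2 (l 0%N v) = series_op c (G2 v)) ->
  (forall p v, F p v -> F p.+1 (G1 v - v)) ->
  (forall p v, F p v -> F p.+1 (G2 v - v)) ->
  F q u -> l 0%N u = (h - q%:R) *: u -> G1 u = G2 u.
Proof.
move=> P0 hF c0 G1c G2c G1F G2F Fu lu.
apply/subr0_eq; set w := G1 u - G2 u.
have F0u : F 0 u := filt_le FP (leq0n q) Fu.
have cw : series_op c w = (h - q%:R) *: w.
  have -> : series_op c w = series_op c (G1 u) - series_op c (G2 u) by exact: linearB.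
  by rewrite -G1c // -G2c // lu [G1 _]linearZ [G2 _]linearZ -scalerBr.
suff Fw r : F (q + r.+1)%N w.
  by apply: (@filt_eq0 (q + P.+1)%N w _ (Fw P)); lia.
elim: r => [|r IH].
  rewrite addn1 (_ : w = (G1 u - u) - (G2 u - u)); last by rewrite opprB addrA subrK.
  by apply: filtB; [exact: G1F|exact: G2F].
set p := (q + r.+1)%N in IH; rewrite addnS -/p.
have r0 : r.+1%:R != 0 :> K by rewrite pnatr_eq0.
(* The term of index 0 is exactly l_0 because c_0 = 1; what remains raises the degree by at least
   1. *)
pose c' m := if m is 0 then 0 else c m.
have c'w : F p.+1 (series_op c' w).
  by rewrite -addn1; apply: filt_series_op IH => -[].
have cc' : series_op c w = l 0%N w + series_op c' w.
  rewrite /series_op -(prednK P0) !big_ord_recl /= c0 scale1r scale0r add0r.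
  by congr (_ + _); apply: eq_bigr.
(* The eigenvalues h - q and h - p differ by p - q = r + 1, invertible in characteristic 0. *)
rewrite -[w]scale1r -(mulVf r0) -scalerA; apply: (filtZ FP).
rewrite (_ : _ *: w = l 0%N w - (h - p%:R) *: w + series_op c' w).
  by apply: (filtD FP) => //; apply: hF.
rewrite addrAC -cc' cw -scalerBl /p natrD; congr (_ *: _); ring.
Qed.

End Module.

(* [T] intertwines operators on [U0] with operators on the filtered module [U];
   it is the identity for a vertex operator algebra and the truncation for
   power series. *)
Section Transfer.
Variables (U : lmodType K) (l : nat -> {linear U -> U}) (F : nat -> U -> Prop).
Variable P : nat.
Hypothesis FP : witt_filtration l F P.
Variables (U0 : lmodType K) (T : {linear U0 -> U}) (lim : (nat -> U0) -> U0).
Hypothesis T_lim : forall (u : nat -> U0) w N0,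
  (forall N, (N0 <= N)%N -> T (u N) = w) -> T (lim u) = w.

(** [s] is the sign relating [D j] to l_j: -1 for x^(j+1) d/dx and 1 for L(j). The coefficient of
    index 0 is set to 0 because [opsum] starts at 1. *)
Lemma opsum_transfer (A : nat -> K) (D : nat -> U0 -> U0) (s : K) g :
  F 0 (T g) -> (forall j g, T (D j g) = s *: l j (T g)) ->
  T (opsum lim (fun j g => A j *: D j g) g)
  = s *: series_op l P (fun j => if j is 0 then 0 else A j) (T g).
Proof.
move=> Fg TD; apply: (T_lim (N0 := P.+1)) => N PN.
rewrite linear_sum /series_op -(big_mkord xpredT
  (fun j => (if j is 0 then 0 else A j) *: l j (T g))).
rewrite [LHS](eq_bigr (fun j => s *: (A j *: l j (T g)))); last first.
  by move=> j _; rewrite linearZ /= TD !scalerA mulrC.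
rewrite -scaler_sumr; congr (_ *: _).
have l0 j : (P <= j)%N -> l j (T g) = 0.
  by move=> Pj; apply: (filt_eq0 FP Pj); apply: (filt_op FP (p := 0)).
rewrite [RHS](big_nat_widen _ _ N) ?(ltnW PN) //.
rewrite [RHS]big_mkcond [RHS]big_ltn ?(leq_ltn_trans _ PN) //= scale0r if_same add0r.
rewrite !big_nat; apply: eq_bigr => -[//|j] _.
by case: ltnP => // /l0 ->; rewrite scaler0.
Qed.

Lemma opexp_transfer (a : nat -> K) (D : U0 -> U0) g :
  a 0%N = 0 -> F 0 (T g) ->
  (forall g, F 0 (T g) -> T (D g) = series_op l P a (T g)) ->
  T (opexp lim D g) = exp_op l P a (T g).
Proof.
move=> a0 Fg TD; apply: (T_lim (N0 := P)) => N PN.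
have TDk k : T (iter k D g) = iter k (series_op l P a) (T g).
  elim: k => //= k IH; rewrite -IH TD // IH {IH}.
  by apply: (filt_le FP (leq0n _)) (filt_iter_series_op FP k a0 Fg).
have Pk k : (P <= k)%N -> iter k (series_op l P a) (T g) = 0.
  by move=> Pk; apply: (filt_eq0 FP Pk); apply: (filt_iter_series_op FP (p := 0)).
rewrite linear_sum /exp_op (big_ord_widen N (fun k => k`!%:R^-1 *: iter k _ _)) //.
rewrite [RHS]big_mkcond; apply: eq_bigr => k _; rewrite linearZ /= TDk.
by case: ltnP => // /Pk ->; rewrite scaler0.
Qed.

Lemma opprod_transfer (b : nat -> K) (D : nat -> U0 -> U0) g :
  (0 < P)%N -> F 0 (T g) ->
  (forall j g, F 0 (T g) ->
     T (D j.+1 g) = exp_op l P (single j.+1 (b j.+1)) (T g)) ->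
  T (opprod lim D g) = prod_op l P b P (T g).
Proof.
move=> P0 Fg TD; apply: (T_lim (N0 := P)) => N PN.
rewrite -(prod_op_stable l b (T g) P0 PN) /prod_op; elim: N {PN} => //= N IH.
by rewrite TD IH //; apply: filt_prod_op.
Qed.

End Transfer.

End Witt.

Lemma stable_val_eventually (V : zmodType) (u : nat -> V) w N0 :
  (forall N, (N0 <= N)%N -> u N = w) -> stable_val u = w.
Proof.
move=> uw; rewrite /stable_val.
have Nw : (\forall n \near \oo%classic, u n = w)%classic by exists N0 => // N /= /uw.
apply: (xget_unique 0 Nw) => w' Nw'.
have [N [/= <- <-//]] : exists N, u N = w' /\ u N = w.
have [M _ hM] := Nw'; exists (maxn M N0); split.
  by apply: hM; rewrite /= leq_maxl.
by apply: uw; rewrite leq_maxr.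
Qed.

(** * Power series modulo x^(P+1) *)

Section TruncatedSeries.
Variables (K : numFieldType) (P : nat).
Implicit Types g : fps K.

Lemma fps_addE g h n : (g + h) n = g n + h n. Proof. by []. Qed.
Lemma fps_oppE g n : (- g) n = - g n. Proof. by []. Qed.
Lemma fps_scaleE (x : K) g n : (x *: g) n = x * g n. Proof. by []. Qed.
Lemma fps_sumE (I : Type) (r : seq I) (Q : pred I) (G : I -> fps K) n :
  (\sum_(i <- r | Q i) G i) n = \sum_(i <- r | Q i) G i n.
Proof. by apply: (big_morph (fun g : fps K => g n)). Qed.

(** Subtraction in [nat] makes the factor vanish for n <= j, so one formula covers both branches of
    [fps_mulXn]. *)
Lemma vfieldE j g n : vfield j g n = (n - j)%:R * g (n - j)%N.
Proof.
rewrite /vfield /fps_mulXn /fps_deriv ltnS; case: leqP => nj.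
  by have /eqP -> : (n - j == 0)%N by []; rewrite mul0r.
by rewrite subnSK.
Qed.

Definition fps_trunc g : fps K := fun n => if (n <= P)%N then g n else 0.

Lemma fps_trunc_is_linear : linear fps_trunc.
Proof.
move=> x g h; apply: funext => n; rewrite fps_addE fps_scaleE /fps_trunc.
by case: leqP => // _; rewrite mulr0 addr0.
Qed.
HB.instance Definition _ :=
  GRing.isLinear.Build K (fps K) (fps K) *:%R fps_trunc fps_trunc_is_linear.

(* L(j) corresponds to [- x^(j+1) d/dx]. *)
Definition fps_witt j g : fps K := - fps_trunc (vfield j g).

Lemma fps_wittE j g n :
  fps_witt j g n = if (n <= P)%N then - ((n - j)%:R * g (n - j)%N) else 0.
Proof.
rewrite /fps_witt fps_oppE /fps_trunc vfieldE.
by case: leqP => // _; rewrite oppr0.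
Qed.

Lemma fps_witt_is_linear j : linear (fps_witt j).
Proof.
move=> x g h; apply: funext => n.
rewrite fps_addE fps_scaleE !fps_wittE fps_addE fps_scaleE.
by case: leqP => _; [ring|rewrite mulr0 addr0].
Qed.
HB.instance Definition _ j :=
  GRing.isLinear.Build K (fps K) (fps K) *:%R (fps_witt j) (fps_witt_is_linear j).

(** The span of x^(p+1), ..., x^P. The shift by one makes step P zero and keeps x in step 0 when P >
    0. *)
Definition fps_filt p g := forall n, (n <= p)%N || (P < n)%N -> g n = 0.

Lemma fps_witt_filtration : witt_filtration fps_witt fps_filt P.
Proof.
split.
- by [].
- by move=> p u v hu hv n hn; rewrite fps_addE hu // hv // addr0.
- by move=> p x u hu n hn; rewrite fps_scaleE hu // mulr0.
- by move=> p q u qp hu n hn; apply: hu; lia.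
- move=> p j u hu n hn /=; rewrite fps_wittE; case: leqP => // nP.
  by rewrite hu ?mulr0 ?oppr0 //; lia.
- by move=> u hu; apply: funext => n; apply: hu; lia.
- move=> m n u; apply: funext => i.
  rewrite fps_addE fps_oppE fps_scaleE /= !fps_wittE.
  case: leqP => iP; last by rewrite subrr mulr0.
  rewrite !(leq_trans (leq_subr _ _) iP) -!subnDA [(n + m)%N]addnC.
  have [mni|mni] := leqP (m + n) i; last first.
    have /eqP -> : (i - (m + n) == 0)%N by rewrite subn_eq0 ltnW.
    by rewrite mul0r oppr0 !mulr0 subrr.
  rewrite !natrB ?natrD //; [ring| |].
  - exact: leq_trans (leq_addl _ _) mni.
  - exact: leq_trans (leq_addr _ _) mni.
Qed.

Lemma fps_trunc_lim (u : nat -> fps K) w N0 :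
  (forall N, (N0 <= N)%N -> fps_trunc (u N) = w) -> fps_trunc (fps_lim u) = w.
Proof.
move=> uw; apply: funext => n; rewrite -(uw N0) // /fps_trunc.
case: leqP => // nP; apply: (stable_val_eventually (N0 := N0)) => N NN0.
have := congr1 (@^~ n) (etrans (uw N NN0) (esym (uw N0 (leqnn _)))).
by rewrite /fps_trunc nP.
Qed.

Lemma fps_filt_trunc g : g 0%N = 0 -> fps_filt 0 (fps_trunc g).
Proof. by move=> g0 [|n] hn; rewrite /fps_trunc ?g0 //; case: leqP => //; lia. Qed.

Lemma fps_witt_vfield j g : fps_trunc (vfield j g) = - fps_witt j (fps_trunc g).
Proof.
apply: funext => n; rewrite fps_oppE fps_wittE /fps_trunc vfieldE.
case: leqP => nP; last by rewrite oppr0.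
by rewrite (leq_trans (leq_subr _ _) nP) opprK.
Qed.

Lemma fps_witt0_X : fps_witt 0 (fps_trunc (@fpsX K)) = - fps_trunc (@fpsX K).
Proof.
apply: funext => n; rewrite fps_oppE fps_wittE /fps_trunc /fpsX subn0.
case: leqP => _; last by rewrite oppr0.
by case: eqP => [->|_]; rewrite ?mulr0 ?mulr1.
Qed.

(** The coefficient of x^(j+1) involves only c_0, ..., c_j, and c_j with factor -f_1 = -1. This
    triangular system expresses the invertibility of f'(x). *)
Lemma series_op_fps_inj (c d : nat -> K) (f : fps K) : f 1%N = 1 ->
  series_op fps_witt P c (fps_trunc f) = series_op fps_witt P d (fps_trunc f) ->
  forall j, (j < P)%N -> c j = d j.
Proof.
move=> f1 cd; elim/ltn_ind => j IH jP.
have fpsE a : series_op fps_witt P a (fps_trunc f) j.+1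
    = - \sum_(i < P | (i <= j)%N) a i * ((j.+1 - i)%:R * f (j.+1 - i)%N).
  rewrite /series_op fps_sumE [in RHS]big_mkcond -sumrN; apply: eq_bigr => i _.
  rewrite fps_scaleE /= fps_wittE jP /fps_trunc.
  rewrite (leq_trans (leq_subr _ _) jP); case: leqP => [_|ji].
    by rewrite mulrN.
  have /eqP -> : (j.+1 - i == 0)%N by rewrite subn_eq0.
  by rewrite mul0r !oppr0 mulr0.
have := congr1 (@^~ j.+1) cd; rewrite !fpsE => /oppr_inj.
rewrite (bigD1 (Ordinal jP)) //= [RHS](bigD1 (Ordinal jP)) //=.
rewrite subSnn mul1r f1 !mulr1.
rewrite (eq_bigr (fun i : 'I_P => d i * ((j.+1 - i)%:R * f (j.+1 - i)%N))).
  by move/addIr.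
by move=> i /andP[ij]; rewrite -val_eqE /= => ne; rewrite IH // ltn_neqAle ne.
Qed.

End TruncatedSeries.

(** * The weight filtration of a vertex operator algebra *)

Section VertexOperatorAlgebraFiltration.
Variables (K : numFieldType) (V : lmodType K) (S : voa V).

Definition voa_op (j : nat) : {linear V -> V} := Y S (omega S) (j%:Z + 1).

(** Membership is witnessed by a list of homogeneous vectors, so that additive maps need only be
    examined on eigenvectors of L(0). *)
Definition weight_filt (m : int) (p : nat) (v : V) : Prop :=
  exists2 s : seq V, v = \sum_(x <- s) x &
    forall x, x \in s -> exists2 n : int, n <= m - p%:Z & weight_space S n x.

(** The central term vanishes: m + n = 0 with m, n >= 0 forces m = 0, where m^3 - m = 0. *)
Lemma voa_op_bracket m n v :
  voa_op m (voa_op n v) - voa_op n (voa_op m v)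
  = (m%:R - n%:R) *: voa_op (m + n) v.
Proof.
have := L_virasoro (voaP S) m n v; rewrite /L -/(voa_op m) -/(voa_op n) => ->.
rewrite -PoszD -/(voa_op (m + n)) rmorphB /=.
case: ifP => [|_]; last by rewrite scale0r addr0.
rewrite eqz_nat addn_eq0 => /andP[/eqP -> _].
by rewrite expr0n subrr mul0r mul0r scale0r addr0.
Qed.

Lemma weight_space_op (n : int) j x : weight_space S n x ->
  weight_space S (n - j%:Z) (voa_op j x).
Proof.
rewrite /weight_space /= => nx; have := voa_op_bracket 0 j x.
rewrite -[voa_op 0 x]/(L S 0 x) nx linearZ /= => /(canRL (subrK _)).
rewrite -[voa_op 0 _]/(L S 0 _) => ->.
by rewrite add0n sub0r -scalerDl rmorphB addrC.
Qed.

Variables (m N : int).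
Hypothesis low : forall (n : int) v, n < N -> weight_space S n v -> v = 0.

Lemma weight_filt_weight p (n : int) x :
  n <= m - p%:Z -> weight_space S n x -> weight_filt m p x.
Proof.
move=> np nx; exists [:: x]; first by rewrite big_seq1.
by move=> y; rewrite inE => /eqP ->; exists n.
Qed.

Lemma weight_filt0 p : weight_filt m p 0.
Proof. by exists [::]; rewrite ?big_nil. Qed.

Lemma weight_filtD p u v :
  weight_filt m p u -> weight_filt m p v -> weight_filt m p (u + v).
Proof.
move=> [s -> hs] [t -> ht]; exists (s ++ t); first by rewrite big_cat.
by move=> x; rewrite mem_cat => /orP[/hs|/ht].
Qed.

Lemma weight_filt_map p q (G : V -> V) v : G 0 = 0 -> {morph G : x y / x + y} ->
  (forall (n : int) x, n <= m - p%:Z -> weight_space S n x -> weight_filt m q (G x)) ->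
  weight_filt m p v -> weight_filt m q (G v).
Proof.
move=> G0 GD hG [s -> hs]; rewrite (big_morph G GD G0) big_seq.
elim/big_ind: _ => [||x /hs[n np nx]]; [exact: weight_filt0|exact: weight_filtD|].
exact: hG np nx.
Qed.

(** Weights in step P are at most m - P, below the lower bound N of the grading, so that step is
    zero. *)
Lemma voa_filtration P : m - P%:Z < N -> witt_filtration voa_op (weight_filt m) P.
Proof.
move=> mPN; split.
- exact: weight_filt0.
- exact: weight_filtD.
- move=> p x u; apply: (@weight_filt_map p p ( *:%R x)).
  + exact: scaler0.
  + exact: scalerDr.
  + move=> n y np ny; apply: (weight_filt_weight np).
    by rewrite /weight_space /= /L linearZ /= -[Y _ _ _ y]/(L S 0 y) ny !scalerA mulrC.
- move=> p q u qp [s -> hs]; exists s => // x /hs[n np nx].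
  by exists n => //; apply: le_trans np _; rewrite lerB // lez_nat.
- move=> p j u; apply: weight_filt_map; [exact: linear0|exact: linearD|].
  move=> n x np /weight_space_op nx; apply: weight_filt_weight (nx j).
  by rewrite PoszD opprD addrA lerD2r.
- move=> u [s -> hs]; rewrite big_seq big1 // => x /hs[n nP].
  by apply: low; apply: le_lt_trans mPN.
- exact: voa_op_bracket.
Qed.

(** L(0) preserves weights; the expression vanishes on weight m - p, and any smaller weight is
    already at most m - p - 1. *)
Lemma weight_filt_eigen p v : weight_filt m p v ->
  weight_filt m p.+1 (voa_op 0 v - (m%:~R - p%:R) *: v).
Proof.
apply: (@weight_filt_map p p.+1 (fun v => voa_op 0 v - (m%:~R - p%:R) *: v)).
- by rewrite linear0 scaler0 subrr.
- by move=> x y; rewrite linearD scalerDr opprD addrACA.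
move=> n x np nx; rewrite -[voa_op 0 x]/(L S 0 x) nx -scalerBl.
have [->|ne] := eqVneq n (m - p%:Z).
  by rewrite rmorphB /= subrr scale0r; apply: weight_filt0.
have np1 : n <= m - p.+1%:Z by lia.
apply: (weight_filt_weight np1).
by rewrite /weight_space /= /L linearZ /= -[Y _ _ _ x]/(L S 0 x) nx !scalerA mulrC.
Qed.

End VertexOperatorAlgebraFiltration.

(** * The two operators on power series, modulo x^(P+1) *)

(** As l_j stands for - x^(j+1) d/dx, the coefficients acquire the minus sign that [phi] carries by
    definition; both modules thus share one coefficient sequence. *)
Lemma exp_sum_vfield_trunc (K : numFieldType) (P : nat) (A : nat -> K) g :
  g 0%N = 0 ->
  fps_trunc P (exp_sum_vfield A g)
  = exp_op (fps_witt P) P (fun j => - (if j is 0 then 0 else A j)) (fps_trunc P g).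
Proof.
move=> g0.
apply: (opexp_transfer (fps_witt_filtration K P) (T := fps_trunc P)
  (@fps_trunc_lim K P)).
- by rewrite oppr0.
- exact: fps_filt_trunc.
move=> h Fh; rewrite series_opN -scaleN1r.
apply: (opsum_transfer (fps_witt_filtration K P) (T := fps_trunc P)
  (@fps_trunc_lim K P)) => // j u.
by rewrite /= fps_witt_vfield scaleN1r.
Qed.

Lemma prod_exp_vfield_trunc (K : numFieldType) (P : nat) (b : nat -> K) g :
  (0 < P)%N -> g 0%N = 0 ->
  fps_trunc P (prod_exp_vfield b g)
  = prod_op (fps_witt P) P (fun j => - b j) P (fps_trunc P g).
Proof.
move=> P0 g0.
apply: (opprod_transfer (fps_witt_filtration K P) (T := fps_trunc P)
  (@fps_trunc_lim K P)) => //.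
  exact: fps_filt_trunc.
move=> j h Fh.
apply: (opexp_transfer (fps_witt_filtration K P) (T := fps_trunc P)
  (@fps_trunc_lim K P)) => // u Fu.
rewrite (series_op_singleE (fps_witt_filtration K P)) // linearZ /= fps_witt_vfield.
by rewrite scalerN scaleNr.
Qed.

(** * The two automorphisms on vectors of bounded weight *)

Section Phi.
Variables (K : numFieldType) (V : lmodType K) (S : voa V).
Variables (m N : int) (P : nat).
Hypothesis low : forall (n : int) v, n < N -> weight_space S n v -> v = 0.
Hypothesis mPN : m - P%:Z < N.

Let FV := voa_filtration low mPN.

Let lim_id (u : nat -> V) w N0 :
  (forall n, (N0 <= n)%N -> idfun (u n) = w) -> idfun (stable_val u) = w.
Proof. exact: stable_val_eventually. Qed.

Lemma phiE (A : nat -> K) v : weight_filt S m 0 v ->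
  phi S A v = exp_op (voa_op S) P (fun j => - (if j is 0 then 0 else A j)) v.
Proof.
move=> Fv; apply: (opexp_transfer FV (T := idfun) lim_id) => //=.
  by rewrite oppr0.
move=> w Fw; rewrite series_opN; congr (- _).
rewrite -[RHS]scale1r.
apply: (opsum_transfer FV (T := idfun) lim_id A (D := fun j => L S j%:Z) Fw).
by move=> j u; rewrite scale1r.
Qed.

Lemma phi_tildeE (b : nat -> K) v : (0 < P)%N -> weight_filt S m 0 v ->
  phi_tilde S b v = prod_op (voa_op S) P (fun j => - b j) P v.
Proof.
move=> P0 Fv; apply: (opprod_transfer FV (T := idfun) lim_id) => // j w Fw.
apply: (opexp_transfer FV (T := idfun) lim_id) => // u Fu.
by rewrite (series_op_singleE FV).
Qed.

End Phi.

(** * Comparison of the two automorphisms *)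

Lemma phi_tilde_eq_phi (K : numFieldType) (V : lmodType K) (S : voa V)
    (f : fps K) (A b : nat -> K) : f 1%N = 1 ->
  exp_sum_vfield A (@fpsX K) = f -> prod_exp_vfield b (@fpsX K) = f ->
  phi_tilde S b = phi S A.
Proof.
move=> f1 fA fb; apply: funext => v.
have [s [c [wc ->]]] := weight_decomposition (voaP S) v.
have [N low] := weight_bounded_below (voaP S).
have [m sm] : exists m : int, forall n, n \in s -> n <= m.
  elim: s => [|n s [m sm]]; first by exists 0.
  exists (Num.max n m) => k; rewrite inE le_max => /predU1P[->|/sm ->].
    by rewrite lexx.
  by rewrite orbT.
(* Any P > m - N serves: step P then has only weights below N. *)
pose P := `|m - N|.+1%N.
have P0 : (0 < P)%N by [].
have mPN : m - P%:Z < N by rewrite /P; lia.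
have FV := voa_filtration low mPN.
have Fc n : n \in s -> weight_filt S m `|m - n| (c n).
  by move=> /sm nm; apply: weight_filt_weight (wc n); lia.
have Fv : weight_filt S m 0 (\sum_(n <- s) c n).
  rewrite big_seq; apply: (filt_sum FV) => n /Fc; exact: (filt_le FV).
rewrite (phi_tildeE low mPN) // (phiE low mPN) //.
set a := fun j => - (if j is 0 then 0 else A j).
set b' := fun j => - b j.
have a0 : a 0%N = 0 by rewrite /a oppr0.
pose cA := witt_Ad P a (single 0 1); pose cb := witt_prod P b' P.
have FS := fps_witt_filtration K P.
have FX : fps_filt P 0 (fps_trunc P (@fpsX K)) by exact: fps_filt_trunc.
have TfA := exp_sum_vfield_trunc P A (erefl (@fpsX K 0%N)).
have Tfb := prod_exp_vfield_trunc b P0 (erefl (@fpsX K 0%N)).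
have l0X : series_op (fps_witt P) P (single 0 1) (fps_trunc P (@fpsX K))
    = - fps_trunc P (@fpsX K).
  by rewrite (series_op_singleE FS) // scale1r; apply: fps_witt0_X.
(* On x the operator l_0 acts by -1, so both conjugated series send f to -f modulo x^(P+1);
   injectivity then identifies their coefficients. *)
have cAb j : (j < P)%N -> cb j = cA j.
  move: j; apply: (series_op_fps_inj f1).
  rewrite -{1}fb -fA TfA Tfb -/a -/b' /cA /cb.
  rewrite -(exp_op_series_op FS) // -(prod_op_series_op FS) //.
  by rewrite l0X !linearN /= -TfA -Tfb fA fb.
(* By linearity the homogeneous components suffice; since n <= m, the one of weight n lies in step q
   = m - n and has eigenvalue n = m - q. *)
rewrite !linear_sum !big_seq; apply: eq_bigr => n ns.
apply: (eq_of_series_op_eigen FV (h := m%:~R) (c := cb) (q := `|m - n|%N)) => //.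
- exact: weight_filt_eigen.
- exact: witt_prod0.
- by move=> w Fw; rewrite -(prod_op_series_op FV) // (series_op_singleE FV) // scale1r.
- move=> w Fw; rewrite (eq_series_op _ _ cAb) -(exp_op_series_op FV) //.
  by rewrite (series_op_singleE FV) // scale1r.
- by move=> p w Fw; apply: (prod_op_sub FV).
- by move=> p w Fw; apply: (exp_op_sub FV).
- exact: Fc.
rewrite -[voa_op S 0 _]/(L S 0 _) wc; congr (_ *: _).
have := sm n ns; rewrite -subr_ge0 => nm.
by rewrite pmulrn gez0_abs // -rmorphB subKr.
Qed.

Theorem theorem2p3 (R : realType) (V : lmodType R[i]) (S : voa V)
    (f : fps R[i]) (A b : nat -> R[i])
    (f0 : f 0%N = 0) (f1 : f 1%N = 1)
    (fA : exp_sum_vfield A (@fpsX R[i]) = f)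
    (fb : prod_exp_vfield b (@fpsX R[i]) = f) :
  phi_tilde S b = phi S A.
Proof. exact: phi_tilde_eq_phi f1 fA fb. Qed.
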